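(* Let $U,V\in\mathrm{SpSt}(2n,2k)$. If $$N:=(U^+V)^{-1}\,\mathrm{sqrt_m}(U^+VV^+U)\in\mathrm{Sp}(2k,\mathbb{R})$$ and $$H:=2(VN+U)(U^+VN+I_{2k})^{-1}-2U\in\mathrm{Hor}^{\rho,h}_U\mathrm{SpSt}(2n,2k)$$ are well-defined, it holds that $$\mathcal{R}^{\mathrm{SpSt}}_U(H)=VN.$$
   Context: Let $k\le n$ be positive integers, $J_{2m}=\begin{bmatrix}0&I_m\\-I_m&0\end{bmatrix}$, and for a real $2a\times 2b$ matrix $A$ put $A^+:=J_{2b}^TA^TJ_{2a}$. $\mathrm{Sp}(2k,\mathbb{R})=\{N\in\mathbb{R}^{2k\times2k}:N^+N=I_{2k}\}$. $\mathrm{SpSt}(2n,2k)=\{U\in\mathbb{R}^{2n\times2k}:U^+U=I_{2k}\}$. $\mathrm{Hor}^{\rho,h}_U\mathrm{SpSt}(2n,2k)=\{\Delta\in\mathbb{R}^{2n\times2k}:U^+\Delta=0\}$. $\mathrm{sqrt_m}$ is the principal matrix square root. The Cayley transform is $\mathrm{cay}(X)=(I+X)(I-X)^{-1}$. The Cayley retraction on $\mathrm{SpSt}(2n,2k)$ is $\mathcal{R}^{\mathrm{SpSt}}_U(\Delta)=\mathrm{cay}\left(\frac12\tilde\Omega(U,\Delta)\right)U$, where $\tilde\Omega(U,\Delta)=\left(I_{2n}-\frac12UU^+\right)\Delta U^+-U\Delta^+\left(I_{2n}-\frac12UU^+\right)$. *)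

(* Defs.v *)
From HB Require Import structures.
From mathcomp Require Import all_boot all_order all_algebra.
From mathcomp Require Import complex.
From mathcomp Require Import all_classical all_reals.

Set Implicit Arguments.
Unset Strict Implicit.
Unset Printing Implicit Defensive.

Import Order.TTheory GRing.Theory Num.Theory.

Local Open Scope classical_set_scope.
Local Open Scope ring_scope.

Definition sympJ (R : realType) (m : nat) : 'M[R]_(m + m) :=
  block_mx 0 1%:M (- 1%:M) 0.

(* The symplectic adjoint, written A^+ on paper. *)
Definition sadj (R : realType) (a b : nat) (A : 'M[R]_(a + a, b + b)) :
    'M[R]_(b + b, a + a) :=
  (sympJ R b)^T *m A^T *m sympJ R a.

Definition Sp (R : realType) (k : nat) : set 'M[R]_(k + k) :=
  [set N | sadj N *m N = 1%:M].

Definition SpSt (R : realType) (n k : nat) : set 'M[R]_(n + n, k + k) :=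
  [set U | sadj U *m U = 1%:M].

Definition HorSpSt (R : realType) (n k : nat) (U : 'M[R]_(n + n, k + k)) :
    set 'M[R]_(n + n, k + k) :=
  [set D | sadj U *m D = 0].

(* S is a square root of A whose complex eigenvalues all lie in the open
   right half-plane. Such an S is unique when it exists. *)
Definition is_principal_sqrt (R : realType) (m : nat) (A S : 'M[R]_m) : Prop :=
  S *m S = A /\
  forall z : R[i],
    eigenvalue (map_mx (real_complex R) S) z -> 0 < complex.Re z.

Definition has_principal_sqrt (R : realType) (m : nat) (A : 'M[R]_m) : Prop :=
  exists S : 'M[R]_m, is_principal_sqrt A S.

(* Junk value 0 when A has no principal square root. *)
Definition sqrtm (R : realType) (m : nat) (A : 'M[R]_m) : 'M[R]_m :=
  xget 0 [set S | is_principal_sqrt A S].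

(* invmx is total, so cay X is meaningful only under cay_defined X. *)
Definition cay_defined (R : realType) (m : nat) (X : 'M[R]_m) : Prop :=
  1%:M - X \in unitmx.

Definition cay (R : realType) (m : nat) (X : 'M[R]_m) : 'M[R]_m :=
  (1%:M + X) *m invmx (1%:M - X).

Definition tOmega (R : realType) (n k : nat) (U D : 'M[R]_(n + n, k + k)) :
    'M[R]_(n + n) :=
  (1%:M - 2^-1 *: (U *m sadj U)) *m D *m sadj U
  - U *m sadj D *m (1%:M - 2^-1 *: (U *m sadj U)).

Definition cay_retr_defined (R : realType) (n k : nat)
    (U D : 'M[R]_(n + n, k + k)) : Prop :=
  cay_defined (2^-1 *: tOmega U D).

Definition cay_retr (R : realType) (n k : nat) (U D : 'M[R]_(n + n, k + k)) :
    'M[R]_(n + n, k + k) :=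
  cay (2^-1 *: tOmega U D) *m U.

(* Main.v *)
Require Import Defs.
From HB Require Import structures.
From mathcomp Require Import all_boot all_order all_algebra.
From mathcomp Require Import complex.
From mathcomp Require Import all_classical all_reals.

Set Implicit Arguments.
Unset Strict Implicit.
Unset Printing Implicit Defensive.

Import Order.TTheory GRing.Theory Num.Theory.
Local Open Scope ring_scope.

(** Put [S := sqrtm (U^+ V V^+ U)], [W := V N] and [K := H / 2]. Since
    [U^+ V V^+ U] is fixed by the symplectic adjoint, the adjoint of [S] is
    again a principal square root of it; such a root is unique
    ([principal_sqrt_uniq], a consequence of Sylvester's theorem on the
    equation [A X = X B]), so [S^+ = S] ([sadj_principal_sqrt]). Hence
    [N^+ N = S (S S)^-1 S = 1], so [N] is symplectic, [W] lies in [SpSt] like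
    [V], and [U^+ W = S] is self-adjoint.

    The rest uses only these last facts. Writing [K = (W + U) (S + 1)^-1 - U],
    one finds [U^+ K = 0], so that half of the generator of the retraction is
    [X = K U^+ - U K^+]. It acts on the column span of [(U, K)] by [X U = K]
    and [X K = - U K^+ K], where [K^+ K = 2 (S + 1)^-1 - 1]. As [1 + K^+ K] is
    invertible, so is [1 - X] ([cay_generator_unit]). The same formulas give
    [X (U + W) = W - U] ([cay_retr_log]), which says [(1 - X) (U + W) = 2 U]
    and [(1 + X) (U + W) = 2 W], that is, [cay X U = W] ([cay_swap]). *)

(** * Uniqueness of the principal square root *)

Lemma eigenvalueE (F : fieldType) (m : nat) (A : 'M[F]_m) (z : F) :
  eigenvalue A z = (A - z%:M \notin unitmx).
Proof. by rewrite /eigenvalue /eigenspace kermx_eq0 row_free_unit. Qed.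

(** Sylvester's theorem. The characteristic polynomial of [A] kills [A], hence
    kills [X] on the left; moving each factor [A - z] across [X] turns it into
    [B - z], which is invertible when [z] is an eigenvalue of [A]. *)
Lemma sylvester_eq0 (F : closedFieldType) (m n : nat) (A : 'M[F]_m)
    (B : 'M[F]_n) (X : 'M[F]_(m, n)) :
  A *m X = X *m B ->
  (forall z, eigenvalue A z -> ~~ eigenvalue B z) -> X = 0.
Proof.
case: m A X => [|m] A X AX dis; first exact: flatmx0.
have [r Dr] := closed_field_poly_normal (char_poly A).
move: Dr; rewrite (monicP (char_poly_monic A)) scale1r => Dr.
have Br z : z \in r -> B - z%:M \in unitmx.
  move=> zr; apply: contraNT (dis z _); first by rewrite eigenvalueE.
  by rewrite eigenvalue_root_char Dr root_prod_XsubC.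
have: horner_mx A (\prod_(z <- r) ('X - z%:P)) *m X = 0.
  by rewrite -Dr Cayley_Hamilton mul0mx.
elim: r Br {Dr} => [|z r IHr] Br.
  by rewrite big_nil rmorph1 mul1mx.
rewrite big_cons mulrC rmorphM /= rmorphB /= horner_mx_X horner_mx_C.
rewrite -mulmxE -mulmxA mulmxBl AX -scalar_mxC -mulmxBr mulmxA => P0.
apply: IHr => [y yr|]; first by apply: Br; rewrite in_cons yr orbT.
have uz : B - z%:M \in unitmx by apply: Br; rewrite in_cons eqxx.
by rewrite -[LHS](mulmxK uz) P0 mul0mx.
Qed.

(** If [S S = T T] then [X := S - T] satisfies [S X = X (- T)], and the
    spectra of [S] and [- T] lie in opposite open half-planes. *)
Lemma principal_sqrt_uniq (R : realType) (m : nat) (A S T : 'M[R]_m) :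
  is_principal_sqrt A S -> is_principal_sqrt A T -> S = T.
Proof.
move=> [SA Spos] [TA Tpos]; apply/eqP; rewrite -subr_eq0; apply/eqP.
apply: (@map_mx_inj _ _ (real_complex R)); rewrite map_mx0.
pose f := map_mx (real_complex R).
apply: (@sylvester_eq0 _ _ _ (f _ _ S) (- f _ _ T)).
  rewrite /f mulmxN -!map_mxM -map_mxN; congr map_mx.
  by rewrite mulmxBr mulmxBl opprB SA TA.
move=> z /Spos z0; apply/negP => Tz.
suff /Tpos : eigenvalue (f _ _ T) (- z).
  by rewrite raddfN /= oppr_gt0 ltNge ltW.
move: Tz; rewrite !eigenvalueE rmorphN opprK; apply: contra => u.
by rewrite -opprD -scaleN1r unitmxZ // unitrN1.
Qed.

(** * The symplectic adjoint *)

Lemma tr_sympJ (R : realType) (m : nat) : (sympJ R m)^T = - sympJ R m.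
Proof.
by rewrite /sympJ tr_block_mx opp_block_mx !trmx0 raddfN /= trmx1 oppr0 opprK.
Qed.

Lemma sympJ_sqr (R : realType) (m : nat) : sympJ R m *m sympJ R m = - 1%:M.
Proof.
rewrite /sympJ mulmx_block !mul0mx !mulmx0 !mul1mx !mulmx1 addr0 !add0r addr0.
by rewrite (scalar_mx_block _ _ (1 : R)) opp_block_mx oppr0.
Qed.

Lemma sympJ_trK (R : realType) (m : nat) : sympJ R m *m (sympJ R m)^T = 1%:M.
Proof. by rewrite tr_sympJ mulmxN sympJ_sqr opprK. Qed.

Lemma sympJ_trVK (R : realType) (m : nat) : (sympJ R m)^T *m sympJ R m = 1%:M.
Proof. by rewrite tr_sympJ mulNmx sympJ_sqr opprK. Qed.

Lemma sadjM (R : realType) (a b c : nat) (A : 'M[R]_(a + a, b + b))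
    (B : 'M[R]_(b + b, c + c)) : sadj (A *m B) = sadj B *m sadj A.
Proof.
rewrite /sadj trmx_mul !mulmxA; congr (_ *m _ *m _).
by rewrite -[in RHS](mulmxA _ (sympJ R b)) sympJ_trK mulmx1.
Qed.

Lemma sadjK (R : realType) (a b : nat) (A : 'M[R]_(a + a, b + b)) :
  sadj (sadj A) = A.
Proof.
rewrite /sadj !trmx_mul !trmxK !tr_sympJ !(mulmxN, mulNmx) opprK.
rewrite !mulmxA sympJ_sqr !mulNmx mul1mx -mulmxA sympJ_sqr.
by rewrite mulmxN mulmx1 opprK.
Qed.

Lemma sadjD (R : realType) (a b : nat) (A B : 'M[R]_(a + a, b + b)) :
  sadj (A + B) = sadj A + sadj B.
Proof. by rewrite /sadj linearD /= mulmxDr mulmxDl. Qed.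

Lemma sadjB (R : realType) (a b : nat) (A B : 'M[R]_(a + a, b + b)) :
  sadj (A - B) = sadj A - sadj B.
Proof. by rewrite /sadj linearB /= mulmxBr mulmxBl. Qed.

Lemma sadjZ (R : realType) (a b : nat) (c : R) (A : 'M[R]_(a + a, b + b)) :
  sadj (c *: A) = c *: sadj A.
Proof. by rewrite /sadj linearZ /= -scalemxAr -scalemxAl. Qed.

Lemma sadj0 (R : realType) (a b : nat) :
  sadj (0 : 'M[R]_(a + a, b + b)) = 0.
Proof. by rewrite /sadj trmx0 mulmx0 mul0mx. Qed.

Lemma sadj1 (R : realType) (a : nat) : sadj (1%:M : 'M[R]_(a + a)) = 1%:M.
Proof. by rewrite /sadj trmx1 mulmx1 sympJ_trVK. Qed.

Lemma sadj_unitmx (R : realType) (a : nat) (A : 'M[R]_(a + a)) :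
  (sadj A \in unitmx) = (A \in unitmx).
Proof.
have [uJ' uJ] := mulmx1_unit (sympJ_trVK R a).
by rewrite /sadj !unitmx_mul uJ' uJ unitmx_tr andbT.
Qed.

Lemma sadj_invmx (R : realType) (a : nat) (A : 'M[R]_(a + a)) :
  A \in unitmx -> sadj (invmx A) = invmx (sadj A).
Proof.
move=> uA; have uA' : sadj A \in unitmx by rewrite sadj_unitmx.
by rewrite -[LHS]mulmx1 -(mulmxV uA') mulmxA -sadjM mulmxV // sadj1 mul1mx.
Qed.

(** [sadj S] is similar to the transpose of [S], so it has the same complex
    spectrum. *)
Lemma sadj_principal_sqrt (R : realType) (a : nat) (A S : 'M[R]_(a + a)) :
  sadj A = A -> is_principal_sqrt A S -> sadj S = S.
Proof.
move=> sA pS; apply: principal_sqrt_uniq (pS); case: pS => SS Spos.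
split=> [|z]; first by rewrite -sadjM SS.
move=> ev; apply: Spos; move: ev.
rewrite !eigenvalueE; apply: contra => uS.
pose f := map_mx (real_complex R).
have JJ : f _ _ (sympJ R a)^T *m f _ _ (sympJ R a) = 1%:M.
  by rewrite /f -map_mxM sympJ_trVK map_mx1.
have [uJ' uJ] := mulmx1_unit JJ.
have -> : map_mx (real_complex R) (sadj S) - z%:M =
    f _ _ (sympJ R a)^T *m (f _ _ S - z%:M)^T *m f _ _ (sympJ R a).
  rewrite linearB /= tr_scalar_mx mulmxBr mulmxBl /sadj !map_mxM /= /f.
  by rewrite scalar_mxC -(mulmxA z%:M) JJ mulmx1 map_trmx.
by rewrite !unitmx_mul unitmx_tr uJ' uJ uS.
Qed.

(** * The Cayley transform *)

(** The kernel of [1 - X] lies in the column span of [(U, K)], on which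
    [1 - X] is invertible as soon as [1 + K^+ K] is. *)
Lemma cay_generator_unit (R : realType) (n k : nat)
    (U K : 'M[R]_(n + n, k + k)) :
  sadj U *m U = 1%:M -> sadj U *m K = 0 -> sadj K *m U = 0 ->
  1%:M + sadj K *m K \in unitmx ->
  cay_defined (K *m sadj U - U *m sadj K).
Proof.
move=> UU UK KU uK; rewrite /cay_defined -row_full_unit -cokermx_eq0.
set X := K *m _ - _; set C := cokermx _.
have CE : C = K *m (sadj U *m C) - U *m (sadj K *m C).
  have := mulmx_coker (1%:M - X); rewrite -/C mulmxBl mul1mx => /subr0_eq {1}->.
  by rewrite mulmxBl !mulmxA.
have Ua : sadj U *m C = - (sadj K *m C).
  by rewrite {1}CE mulmxBr !mulmxA UK UU !mul0mx sub0r mul1mx.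
have Ka : sadj K *m C = sadj K *m K *m (sadj U *m C).
  by rewrite {1}CE mulmxBr !mulmxA KU !mul0mx subr0.
have a0 : sadj U *m C = 0.
  rewrite -[LHS](mulKmx uK) [X in _ *m X]mulmxDl mul1mx -Ka.
  by rewrite {1}Ua addNr mulmx0.
move: Ua; rewrite a0 => /esym/eqP; rewrite oppr_eq0 => /eqP b0.
by rewrite CE a0 b0 !mulmx0 subr0.
Qed.

Lemma cay_swap (R : realType) (m p : nat) (X : 'M[R]_m) (U W : 'M[R]_(m, p)) :
  cay_defined X -> X *m (U + W) = W - U -> cay X *m U = W.
Proof.
move=> dX XE.
have U2 : (1%:M - X) *m (U + W) = 2 *: U.
  by rewrite mulmxBl mul1mx XE opprB addrACA subrr addr0 scaler_nat mulr2n.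
have W2 : (1%:M + X) *m (U + W) = 2 *: W.
  by rewrite mulmxDl mul1mx XE addrC addrA subrK scaler_nat mulr2n.
apply: (scalerI (a := 2)); first by rewrite pnatr_eq0.
by rewrite /cay scalemxAr -U2 -mulmxA mulKmx.
Qed.

(** * Inverting the Cayley retraction *)

(** [H] solves [X (U + W) = W - U] for [X] the halved generator of [H]: with
    [U + W = (K + U) Q], [X U = K] and [X K = - U (2 Q^-1 - 1)] one gets
    [X (K + U) Q = (K + U) Q - 2 U]. Self-adjointness of [U^+ W] is what makes
    [(W + U)^+ (W + U) = 2 Q], hence gives [K^+ K] its closed form. *)
Lemma cay_retr_log (R : realType) (n k : nat) (U W : 'M[R]_(n + n, k + k)) :
  SpSt U -> SpSt W ->
  sadj (sadj U *m W) = sadj U *m W ->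
  sadj U *m W + 1%:M \in unitmx ->
  let H := 2 *: ((W + U) *m invmx (sadj U *m W + 1%:M)) - 2 *: U in
  [/\ HorSpSt U H, cay_retr_defined U H & cay_retr U H = W].
Proof.
rewrite /SpSt /HorSpSt /= => UU WW; set S := sadj U *m W => sS uS.
set Q := S + 1%:M in uS *; set H := _ - _.
have WU : sadj W *m U = S by rewrite -sS /S sadjM sadjK.
have sQ : sadj (invmx Q) = invmx Q by rewrite sadj_invmx // sadjD sS sadj1.
have two0 : (2 : R) != 0 by rewrite pnatr_eq0.
pose K := (W + U) *m invmx Q - U.
have HK : H = 2 *: K by rewrite /H /K scalerBr.
have UK : sadj U *m K = 0.
  by rewrite /K mulmxBr mulmxA mulmxDr UU -/S -/Q mulmxV // subrr.
have KU : sadj K *m U = 0.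
  by rewrite -[LHS]sadjK sadjM sadjK UK sadj0.
have KK : sadj K *m K = 2 *: invmx Q - 1%:M.
  (* [K^+ K = K^+ (W + U) Q^-1] because [K^+ U = 0]; then [K^+ (W + U)]
     is [Q^-1 (W + U)^+ (W + U) - U^+ (W + U) = Q^-1 (2 Q) - Q]. *)
  have WUWU : sadj (W + U) *m (W + U) = 2 *: Q.
    rewrite sadjD mulmxDl !mulmxDr WW UU WU -/S -/Q.
    by rewrite (addrC 1%:M) -/Q scaler_nat mulr2n.
  have UWU : sadj U *m (W + U) = Q by rewrite mulmxDr UU.
  rewrite {2}/K mulmxBr KU subr0 mulmxA {1}/K sadjB sadjM sQ !mulmxBl.
  by rewrite -(mulmxA _ _ (W + U)) WUWU UWU -scalemxAr mulVmx // -scalemxAl mul1mx mulmxV.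
have UWE : U + W = (K + U) *m Q by rewrite /K subrK mulmxKV // addrC.
clearbody K.
have XE : 2^-1 *: tOmega U H = K *m sadj U - U *m sadj K.
  rewrite HK /tOmega sadjZ -scalemxAr -!scalemxAl -scalemxAr -scalemxAl.
  rewrite -scalerBr scalerA mulVf // scale1r.
  rewrite mulmxBl mulmxBr mul1mx mulmx1 -scalemxAl -scalemxAr.
  rewrite -(mulmxA U _ K) UK mulmx0 scaler0 subr0.
  by rewrite -mulmxA (mulmxA (sadj K)) KU mul0mx mulmx0 scaler0 subr0.
have dX : cay_retr_defined U H.
  rewrite /cay_retr_defined XE; apply: cay_generator_unit => //.
  by rewrite KK addrC subrK unitmxZ ?unitfE // unitmx_inv.
split=> //; first by rewrite HK -scalemxAr UK scaler0.
rewrite /cay_retr; apply: cay_swap => //; rewrite XE.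
have XKU : (K *m sadj U - U *m sadj K) *m (K + U) =
    K + U - 2 *: (U *m invmx Q).
  rewrite mulmxBl -!(mulmxA _ (sadj _)) !(mulmxDr (sadj _)).
  rewrite UK KU add0r addr0 UU mulmx1 KK.
  by rewrite mulmxBr mulmx1 -scalemxAr opprB addrA.
rewrite {1}UWE mulmxA XKU mulmxBl -UWE -scalemxAl mulmxKV //.
by rewrite scaler_nat mulr2n opprD addrACA subrr add0r.
Qed.

Theorem proposition5p7 (R : realType) (n k : nat)
    (k_gt0 : (0 < k)%N) (le_kn : (k <= n)%N)
    (U V : 'M[R]_(n + n, k + k)) (hU : SpSt U) (hV : SpSt V)
    (* N is well-defined *)
    (hUV : sadj U *m V \in unitmx)
    (hsqrt : has_principal_sqrt (sadj U *m V *m sadj V *m U)) :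
  let N : 'M[R]_(k + k) :=
    invmx (sadj U *m V) *m sqrtm (sadj U *m V *m sadj V *m U) in
  (* H is well-defined *)
  sadj U *m V *m N + 1%:M \in unitmx ->
  let H : 'M[R]_(n + n, k + k) :=
    2 *: ((V *m N + U) *m invmx (sadj U *m V *m N + 1%:M)) - 2 *: U in
  [/\ Sp N,
      HorSpSt U H,
      cay_retr_defined U H
    & cay_retr U H = V *m N].
Proof.
set M := sadj U *m V in hUV hsqrt *; set A := M *m _ *m U in hsqrt *.
set S := sqrtm A => N uQ H.
have pS : is_principal_sqrt A S.
  exact: (xgetPex 0 hsqrt).
have MV : sadj M = sadj V *m U by rewrite /M sadjM sadjK.
have AE : A = M *m sadj M by rewrite MV mulmxA.
have sS : sadj S = S.
  by apply: sadj_principal_sqrt pS; rewrite AE sadjM sadjK.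
have SS : S *m S = M *m sadj M by case: pS => ->.
have uS : S \in unitmx.
  have : S *m S \in unitmx by rewrite SS unitmx_mul sadj_unitmx hUV.
  by rewrite unitmx_mul => /andP[].
have MN : M *m N = S by rewrite /N mulKVmx.
have hN : Sp N.
  (* [N^+ N S = N^+ M^+ = (M N)^+ = S], and [S] is invertible. *)
  have NM : sadj N *m sadj M = S by rewrite -sadjM MN.
  have NS : N *m S = sadj M.
    by rewrite /N -mulmxA SS mulKmx.
  by rewrite /Sp /= -[LHS](mulmxK uS) -(mulmxA _ N) NS NM mulmxV.
have hW : SpSt (V *m N).
  by rewrite /SpSt /= sadjM -mulmxA (mulmxA (sadj V)) hV mul1mx.
have UW : sadj U *m (V *m N) = S by rewrite mulmxA.
have := @cay_retr_log R n k U (V *m N) hU hW.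
rewrite UW sS -MN => /(_ erefl uQ) /= [h1 h2 h3].
by split.
Qed.
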